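(* Let $G$ be a connected bipartite graph on $n\ge 4$ vertices with bipartition $V=(X,Y)$ and edge set $E$, such that every vertex in $X$ has degree $c$ and every vertex in $Y$ has degree $d$. Let $\lambda_2$ denote the second largest eigenvalue of the adjacency matrix of $G$. Then $$\sqrt{\frac{2(|E|-cd)}{(n-2)(n-3)}}\le\lambda_2\le\sqrt{\frac{2(n-3)(|E|-cd)}{n-2}}.$$
   Context: Graphs are simple, finite and undirected. The adjacency matrix has $(i,j)$ entry $1$ if $i,j$ are adjacent and $0$ otherwise; its eigenvalues are ordered $\lambda_1\ge\lambda_2\ge\cdots\ge\lambda_n$. *)

(* Defs.v *)
From HB Require Import structures.
From mathcomp Require Import all_boot all_order all_algebra.
From mathcomp Require Import polyrcf.
Set Implicit Arguments.
Unset Strict Implicit.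
Unset Printing Implicit Defensive.
Import Order.TTheory GRing.Theory Num.Theory.
Local Open Scope ring_scope.

Record sgraph := SGraph {
  vertex : finType;
  adj : rel vertex;
  adj_sym : symmetric adj;
  adj_irrefl : irreflexive adj }.

Section Graph.
Variable G : sgraph.

Definition edges : {set {set vertex G}} :=
  [set [set p.1; p.2] | p : vertex G * vertex G & adj p.1 p.2].

Definition degree (v : vertex G) : nat := #|[set u | adj v u]|.

Definition connected_graph : Prop :=
  (0 < #|vertex G|)%N /\ forall u v : vertex G, connect (@adj G) u v.

Definition bipartition (X Y : {set vertex G}) : Prop :=
  [/\ X :|: Y = [set: vertex G],
      [disjoint X & Y] &
      forall u v, adj u v ->
        (u \in X) && (v \in Y) || (u \in Y) && (v \in X)].

(* The vertices are numbered by enum_val; the eigenvalues do not depend on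
   the numbering. *)
Definition adjacency_matrix (R : pzSemiRingType) : 'M[R]_#|vertex G| :=
  \matrix_(i, j) (adj (enum_val i) (enum_val j))%:R.

End Graph.

(* All eigenvalues in R, in nonincreasing order, each repeated according to its
   multiplicity as a root of the characteristic polynomial. *)
Definition eigenvalues (R : rcfType) (n : nat) (A : 'M[R]_n) : seq R :=
  sort >=%R (flatten [seq nseq (mup x (char_poly A)) x
                     | x <- rootsR (char_poly A)]).

Lemma eigenvaluesP (R : rcfType) (n : nat) (A : 'M[R]_n) (s : seq R) :
  char_poly A = \prod_(x <- s) ('X - x%:P) -> sorted >=%R s ->
  eigenvalues A = s.
Proof.
move=> charA s_sorted.
have ge_total : total (>=%R : rel R) by move=> x y; exact: le_total.
have ge_trans : transitive (>=%R : rel R) by move=> y x z xy yz; exact: le_trans yz xy.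
have ge_anti : antisymmetric (>=%R : rel R).
  by move=> x y; rewrite andbC; exact: le_anti.
apply: (sorted_eq ge_trans ge_anti) => //; first exact: sort_sorted.
rewrite perm_sort; apply/allP => x _ /=; apply/eqP.
have p_neq0 : char_poly A != 0 by rewrite monic_neq0 ?char_poly_monic.
rewrite count_flatten -map_comp.
have -> : count_mem x s = mup x (char_poly A) by rewrite charA mu_prod_XsubC.
rewrite (eq_map (g := fun y => (mup x (char_poly A) * (y == x))%N)); last first.
  by move=> y /=; rewrite count_nseq /= mulnC; case: eqP => [->|]; rewrite ?muln0.
rewrite sumnE big_map -big_distrr /= -[RHS]muln1.
have -> : (\sum_(y <- rootsR (char_poly A)) (y == x))%N
          = count_mem x (rootsR (char_poly A)).
  by rewrite -sum1_count [RHS]big_mkcond; apply: eq_bigr => y _ /=; case: eqP.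
rewrite count_uniq_mem ?uniq_roots //.
rewrite -roots_on_rootsR // in_itv /=.
have [//|/mupNroot ->] := boolP (root (char_poly A) x).
by rewrite !mul0n.
Qed.

Definition lambda2 (R : rcfType) (G : sgraph) : R :=
  (eigenvalues (adjacency_matrix G R))`_1.

(* Main.v *)
(* The spectrum of a biregular bipartite graph is symmetric about 0, and
   sqrt(cd) is its largest eigenvalue: it has the positive eigenvector with
   entries sqrt c on X and sqrt d on Y, while every row of A^2 sums to cd, so
   that a^2 <= cd for each eigenvalue a.  Removing both extreme eigenvalues from
   tr(A^2) = 2|E| leaves n - 2 squares, each at most lambda_2^2 and two of them
   equal to it, with sum 2(|E| - cd); hence
   2 lambda_2^2 <= 2(|E| - cd) <= (n - 2) lambda_2^2, and n - 3 >= 1 gives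
   both bounds. *)
Require Import Defs.
From mathcomp Require Import all_boot all_order all_algebra.
From mathcomp Require Import sesquilinear spectral complex.
From mathcomp Require Import ring lra.
Import Order.TTheory GRing.Theory Num.Theory.
Local Open Scope ring_scope.
Set Implicit Arguments.
Unset Strict Implicit.
Unset Printing Implicit Defensive.

(** * Spectra of real symmetric matrices *)

Lemma char_poly_similar (F : fieldType) (n : nat) (P A B : 'M[F]_n) :
  P \in unitmx -> P *m A = B *m P -> char_poly A = char_poly B.
Proof.
move=> Pu PAB; pose Q := map_mx polyC P.
have detQ : \det Q != 0.
  by rewrite det_map_mx polyC_eq0 -unitfE -unitmxE.
have QAB : Q *m char_poly_mx A = char_poly_mx B *m Q.
  rewrite /char_poly_mx mulmxBr mulmxBl -!map_mxM PAB.
  by rewrite scalar_mxC.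
apply: (mulfI detQ); rewrite /char_poly -det_mulmx QAB det_mulmx.
exact: mulrC.
Qed.

(** Over [complex R] the matrix becomes hermitian, hence unitarily diagonalizable with a real
    diagonal. The real parts of that diagonal give [s], and both identities descend because the
    embedding [f] is injective. *)
Lemma symmetric_spectrum (R : rcfType) (n : nat) (A : 'M[R]_n) :
  A^T = A ->
  exists s : seq R, [/\ size s = n,
    char_poly A = \prod_(x <- s) ('X - x%:P) &
    \tr (A *m A) = \sum_(x <- s) x ^+ 2].
Proof.
move=> At.
pose f := real_complex R : {rmorphism R -> complex R}.
pose B := map_mx f A.
have Breal : B \is a realmx.
  apply/mxOverP => i j; rewrite mxE; apply/complex_realP.
  by exists (A i j).
have Bsym : B \is symmetricmx.
  apply/is_hermitianmxP; rewrite expr0 scale1r.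
  by apply/matrixP => i j; rewrite !mxE -{1}At mxE.
have Bherm := realsym_hermsym Bsym Breal.
have /orthomx_spectralP := symmetric_normalmx Bsym Breal.
set P := spectralmx B; set D := spectral_diag B => BE.
have Pu : P \in unitmx := spectral_unit B.
have Dreal : D \is a realmx := hermitian_spectral_diag_real Bherm.
pose s := [seq complex.Re (D 0 i) | i : 'I_n].
have fRe i : f (complex.Re (D 0 i)) = D 0 i.
  exact: RRe_real (mxOverP Dreal 0 i).
exists s; split.
- by rewrite size_image card_ord.
- apply: (map_poly_inj f); rewrite map_char_poly -/B.
  rewrite (char_poly_similar (P := P) (B := diag_mx D)) //; last first.
    by rewrite {1}BE !mulmxA mulmxV // mul1mx.
  rewrite char_poly_trig ?diag_mx_is_trig // /s big_image rmorph_prod /=.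
  apply: eq_bigr => i _.
  by rewrite map_polyXsubC fRe mxE eqxx mulr1n.
- apply: (fmorph_inj f); rewrite -[LHS]trace_map_mx map_mxM -/B.
  rewrite BE !mulmxA mulmxK // -!mulmxA mxtrace_mulC !mulmxA mulmxK //.
  rewrite mulmx_diag mxtrace_diag /s big_image rmorph_sum /=.
  by apply: eq_bigr => i _; rewrite mxE rmorphXn /= fRe.
Qed.

(** Up to sign the matrix [X + A] is [(- X) - A], and substituting [- X] for [X] is a ring morphism,
    so it commutes with the determinant. *)
Lemma char_poly_opp (R : comNzRingType) (n : nat) (A : 'M[R]_n) :
  char_poly (- A) = (-1) ^+ n * (char_poly A \Po - 'X).
Proof.
pose h : {rmorphism {poly R} -> {poly R}} := comp_poly (- 'X : {poly R}).
rewrite -[_ \Po _]/(h _) /char_poly -det_map_mx -detZ scaleN1r; congr (\det _).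
apply/matrixP => i j; rewrite !mxE rmorphB /= rmorphMn /=.
by rewrite comp_polyX comp_polyC polyCN mulNrn !opprB opprK addrC opprK.
Qed.

Lemma eigenvalues_sorted (R : rcfType) (n : nat) (A : 'M[R]_n) :
  sorted >=%R (eigenvalues A).
Proof. by apply: sort_sorted => x y; exact: le_total. Qed.

Lemma symmetric_eigenvalues (R : rcfType) (n : nat) (A : 'M[R]_n) :
  A^T = A ->
  [/\ size (eigenvalues A) = n,
    char_poly A = \prod_(x <- eigenvalues A) ('X - x%:P) &
    \tr (A *m A) = \sum_(x <- eigenvalues A) x ^+ 2].
Proof.
move=> /symmetric_spectrum [s [sz chA trA]].
have perm_s : perm_eq (sort >=%R s) s by rewrite perm_sort.
have -> : eigenvalues A = sort >=%R s.
  apply: eigenvaluesP; first by rewrite chA (perm_big _ perm_s).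
  by apply: sort_sorted => x y; exact: le_total.
by split; rewrite ?size_sort // (perm_big _ perm_s).
Qed.

Lemma eigenvalues_opp (R : rcfType) (n : nat) (A : 'M[R]_n) :
  A^T = A -> eigenvalues (- A) = rev [seq - x | x <- eigenvalues A].
Proof.
move=> At; have [sz chA _] := symmetric_eigenvalues At.
apply: eigenvaluesP.
  rewrite char_poly_opp chA (perm_big _ (permEl (perm_rev _))) big_map.
  (* With the exponent read as the length of the list, the induction spends one factor -1 on each
     eigenvalue. *)
  rewrite -{1}sz; elim: (eigenvalues A) => [|x s IHs].
    by rewrite !big_nil -[1]/(1%:P) comp_polyC mul1r.
  rewrite !big_cons -IHs rmorphM rmorphB /= comp_polyX comp_polyC polyCN exprS.
  by ring.
rewrite rev_sorted (homo_sorted _ _ (eigenvalues_sorted A)) // => x y /= xy.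
by rewrite lerN2.
Qed.

(** * Sorted sequences symmetric about 0 *)

Lemma nth_rev_opp_fixed (R : rcfType) (s : seq R) (i : nat) :
  s = rev [seq - x | x <- s] -> (i < size s)%N ->
  s`_i = - s`_(size s - i.+1).
Proof.
move=> sE lt_is; rewrite {1}sE nth_rev ?size_map // (nth_map 0) //.
by rewrite ltn_subrL (leq_trans _ lt_is).
Qed.

Lemma sorted_symmetric_second (R : rcfType) (s : seq R) :
  sorted >=%R s -> s = rev [seq - x | x <- s] -> (4 <= size s)%N ->
  let q := \sum_(x <- s) x ^+ 2 - 2 * s`_0 ^+ 2 in
  [/\ 0 <= s`_1, 2 * s`_1 ^+ 2 <= q &
      q <= ((size s)%:R - 2) * s`_1 ^+ 2].
Proof.
move=> s_sorted sE sz4 q.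
have ge_tr : transitive (>=%R : rel R).
  by move=> y x z xy yz; exact: le_trans yz xy.
have mono i j : (i <= j)%N -> (j < size s)%N -> s`_j <= s`_i.
  move=> ij js; apply: (sorted_leq_nth ge_tr _ 0 s_sorted) => //.
    exact: lexx.
  exact: leq_ltn_trans js.
(* Positions 0, 1, [m.+2] and [m.+3] are then distinct, so the two extreme pairs can be split off,
   leaving [m] middle entries. *)
have [m sz] : exists m, size s = m.+4.
  by exists (size s - 4)%N; rewrite -[RHS]addn4 subnK.
have last1 : s`_m.+3 = - s`_0.
  by rewrite (nth_rev_opp_fixed sE) sz // subSS subnn.
have last2 : s`_m.+2 = - s`_1.
  by rewrite (nth_rev_opp_fixed sE) sz // subSnn.
(* The order gives [- s_1 = s_(m+2) <= s_1]. *)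
have s1_ge0 : 0 <= s`_1.
  have := mono 1%N m.+2 isT; rewrite sz last2 => /(_ (ltnW (ltnSn _))).
  by rewrite -subr_ge0 opprK -mulr2n pmulrn_lge0.
have qE : q = 2 * s`_1 ^+ 2 + \sum_(2 <= i < m.+2) s`_i ^+ 2.
  rewrite /q (big_nth 0) sz big_nat_recr //= big_nat_recr //=.
  rewrite big_ltn // big_ltn //= last1 last2 !sqrrN.
  by ring.
(* Such an entry lies between [s_(m+2) = - s_1] and [s_1]. *)
have sq_le i : (1 <= i < m.+3)%N -> s`_i ^+ 2 <= s`_1 ^+ 2.
  move=> /andP[i1 im]; rewrite -(real_normK (num_real s`_i)) lerXn2r ?nnegrE //.
  rewrite ler_norml -last2 !mono // sz //.
  exact: ltnW.
rewrite {}qE; split=> //.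
  by rewrite lerDl sumr_ge0 // => i _; exact: sqr_ge0.
have -> : (size s)%:R - 2 = 2 + m%:R :> R.
  by rewrite sz -addn4 natrD -addrA addrC; congr (_ + _); rewrite -natrB.
rewrite (mulrDl 2 m%:R) lerD2l.
apply: le_trans (_ : \sum_(2 <= i < m.+2) s`_1 ^+ 2 <= _).
  by apply: ler_sum_nat => i /andP[i2 im]; rewrite sq_le // (ltnW i2) ltnW.
by rewrite sumr_const_nat subn2 mulr_natl.
Qed.

(** * Row-sum bound for eigenvalues *)

(** Compare l1 norms in [v *m B = a *: v]: eigenvectors are row vectors here, so after exchanging
    the sums each [|v_i|] is weighted by the i-th absolute row sum of [B]. *)
Lemma eigenvalue_norm_le (R : realFieldType) (n : nat) (B : 'M[R]_n) (r a : R) :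
  (forall i, \sum_j `|B i j| <= r) -> eigenvalue B a -> `|a| <= r.
Proof.
move=> rowB /eigenvalueP[v vB v_neq0].
have v_gt0 : 0 < \sum_i `|v 0 i|.
  rewrite lt_def sumr_ge0 ?andbT //; apply: contra_neq v_neq0 => v0.
  apply/rowP => i; rewrite mxE; apply/normr0_eq0.
  by apply: (psumr_eq0P _ v0).
rewrite -(ler_pM2r v_gt0) mulr_sumr.
have -> : \sum_i `|a| * `|v 0 i| = \sum_j `|\sum_i v 0 i * B i j|.
  apply: eq_bigr => j _; rewrite -normrM.
  by move/rowP: vB => /(_ j); rewrite !mxE => ->.
apply: (le_trans (y := \sum_j \sum_i `|v 0 i| * `|B i j|)).
  apply: ler_sum => j _; apply: le_trans (ler_norm_sum _ _ _) _.
  by apply: ler_sum => i _; rewrite normrM.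
rewrite exchange_big mulr_sumr; apply: ler_sum => i _ /=.
by rewrite -mulr_sumr mulrC ler_wpM2r.
Qed.

Lemma sum_enum_val (R : nmodType) (T : finType) (F : T -> R) :
  \sum_(i < #|T|) F (enum_val i) = \sum_v F v.
Proof. by rewrite [RHS](reindex _ (onW_bij _ (enum_val_bij T))). Qed.

(** * Edge counts and spectrum of bipartite graphs *)

Section BipartiteGraph.
Variables (R : rcfType) (G : sgraph) (X Y : {set vertex G}).
Hypothesis XY : bipartition X Y.
Local Notation A := (adjacency_matrix G R).

Lemma bipartition_memY u : (u \in Y) = (u \notin X).
Proof.
case: XY => cover /disjoint_setI0 dis _.
have := in_setT u; rewrite -cover inE; have := in_set0 u; rewrite -dis inE.
by case: (u \in X); case: (u \in Y).
Qed.

Lemma bipartition_adj u v : adj u v -> (v \in X) = (u \notin X).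
Proof.
case: XY => _ _ bip /bip; rewrite !bipartition_memY.
by case: (u \in X); case: (v \in X).
Qed.

Lemma sum_adj (u : vertex G) : (\sum_v adj u v)%N = degree u.
Proof.
rewrite /degree -sum1_card [RHS]big_mkcond; apply: eq_bigr => v _ /=.
by rewrite inE; case: adj.
Qed.

Lemma sum_adjR (u : vertex G) : \sum_v (adj u v)%:R = (degree u)%:R :> R.
Proof. by rewrite -sum_adj natr_sum. Qed.

(** Every edge has exactly one end in [X]; listing that end first makes edges correspond bijectively
    to the pairs in [D]. *)
Lemma card_edges_bipartite : #|edges G| = (\sum_(u in X) degree u)%N.
Proof.
pose D := [set p : vertex G * vertex G | (p.1 \in X) && adj p.1 p.2].
have -> : edges G = [set [set p.1; p.2] | p in D].
  apply/setP => e; apply/imsetP/imsetP => -[[u v]]; rewrite inE /= => uv ->.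
    have := bipartition_adj uv; have [uX _|uX vX] := boolP (u \in X).
      by exists (u, v); rewrite ?inE /= ?uX.
    by exists (v, u); rewrite ?inE /= ?vX 1?adj_sym ?uv // setUC.
  by case/andP: uv => _ uv; exists (u, v); rewrite ?inE.
rewrite card_in_imset; last first.
  move=> [u v] [u' v']; rewrite !inE /= => /andP[uX uv] /andP[u'X u'v'] E.
  have vX : v \notin X by rewrite (bipartition_adj uv) uX.
  have v'X : v' \notin X by rewrite (bipartition_adj u'v') u'X.
  have /set2P[<-|uE] : u \in [set u'; v'] by rewrite -E set21.
    have /set2P[vE|<-//] : v \in [set u'; v'] by rewrite -E set22.
    by rewrite vE u'X in vX.
  by rewrite -uE uX in v'X.
rewrite -sum1_card.
under [RHS]eq_bigr do rewrite /degree -sum1_card.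
rewrite pair_big_dep /=; by apply: eq_bigl => -[u v]; rewrite !inE.
Qed.

(** The degrees in [X] sum to the number of edges; exchanging the order of summation shows that
    those outside [X] have the same sum. *)
Lemma sum_degree_bipartite : (\sum_(u : vertex G) degree u = 2 * #|edges G|)%N.
Proof.
rewrite card_edges_bipartite (bigID (mem X)) /= mul2n -addnn; congr addn.
under eq_bigr do rewrite -sum_adj.
rewrite exchange_big /= [RHS]big_mkcond /=; apply: eq_bigr => u _.
rewrite -sum_adj big_mkcond; case: ifPn => uX; last first.
  rewrite big1 // => v _; case: ifPn => // vX; case uv: (adj v u) => //.
  by rewrite (bipartition_adj uv) vX in uX.
apply: eq_bigr => v _; rewrite adj_sym; case: ifPn => // vX.
by case uv: (adj u v) => //; rewrite (bipartition_adj uv) uX in vX.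
Qed.

Lemma adjacency_matrix_tr : A^T = A.
Proof. by apply/matrixP => i j; rewrite !mxE adj_sym. Qed.

Lemma trace_adjacency_sqr : \tr (A *m A) = 2 * #|edges G|%:R.
Proof.
rewrite -[2]/(2%:R) -natrM -sum_degree_bipartite natr_sum.
rewrite -[RHS]sum_enum_val /mxtrace; apply: eq_bigr => i _.
rewrite mxE -sum_adjR -[RHS]sum_enum_val; apply: eq_bigr => j _.
by rewrite !mxE [adj (enum_val j) _]adj_sym -natrM mulnb andbb.
Qed.

(* Changing the sign of the coordinates outside [X] conjugates [A] to [- A]. *)
Lemma eigenvalues_bipartite :
  eigenvalues A = rev [seq - x | x <- eigenvalues A].
Proof.
rewrite -(eigenvalues_opp adjacency_matrix_tr) /eigenvalues.
suff -> : char_poly (- A) = char_poly A by [].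
pose sg (i : 'I_#|vertex G|) : R := (-1) ^+ (enum_val i \in X).
pose P := diag_mx (\row_i sg i).
have PP : P *m P = 1%:M.
  rewrite mulmx_diag -diag_const_mx; congr diag_mx.
  by apply/rowP => i; rewrite !mxE -expr2 sqrr_sign.
apply/esym/(@char_poly_similar _ _ P); first exact: (mulmx1_unit PP).1.
rewrite mul_diag_mx mul_mx_diag; apply/matrixP => i j; rewrite !mxE.
case ij: (adj _ _); last by rewrite !(mulr0, oppr0, mul0r).
rewrite /sg (bipartition_adj ij) mulr1 mulN1r.
by case: (_ \in X); rewrite ?opprK.
Qed.

(** * The largest eigenvalue in the biregular case *)

Variables c d : nat.
Hypothesis degX : forall x, x \in X -> degree x = c.
Hypothesis degY : forall y, y \in Y -> degree y = d.

Lemma degree_biregular u : degree u = if u \in X then c else d.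
Proof.
by case: ifPn => uX; [exact: degX | apply: degY; rewrite bipartition_memY].
Qed.

Lemma sum_adjacency_row i :
  \sum_j A i j = (if enum_val i \in X then c else d)%:R.
Proof.
rewrite -degree_biregular -sum_adjR -[RHS]sum_enum_val.
by apply: eq_bigr => j _; rewrite mxE.
Qed.

(** A nonzero entry joins opposite sides. In a sum over [j], this makes a factor depending only on
    the side of [j] constant, so it can be pulled out. *)
Lemma adjacency_mul_other i j a b :
  A i j * (if enum_val j \in X then a else b) =
  A i j * (if enum_val i \in X then b else a).
Proof.
rewrite mxE; case ij: (adj _ _); last by rewrite !mul0r.
by rewrite (bipartition_adj ij); case: (_ \in X).
Qed.

Lemma eigenvalue_biregular_le a : eigenvalue A a -> a ^+ 2 <= c%:R * d%:R.
Proof.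
move=> /eigenvalueP[v vA v_neq0].
have : eigenvalue (A *m A) (a ^+ 2).
  apply/eigenvalueP; exists v => //.
  by rewrite mulmxA vA -scalemxAl vA scalerA.
move/(@eigenvalue_norm_le _ _ _ (c%:R * d%:R)).
rewrite ger0_norm ?sqr_ge0 //; apply => i.
(* The entries are nonnegative, so the absolute values drop and the row sum of the square is a sum
   of row sums of [A]. *)
have -> : \sum_j `|(A *m A) i j| = \sum_k A i k * \sum_j A k j.
  under [RHS]eq_bigr do rewrite mulr_sumr.
  rewrite [RHS]exchange_big; apply: eq_bigr => j _.
  rewrite mxE ger0_norm // sumr_ge0 // => k _.
  by rewrite !mxE mulr_ge0.
under eq_bigr do
  rewrite sum_adjacency_row (fun_if (fun m => m%:R)) adjacency_mul_other.
rewrite -mulr_suml sum_adjacency_row.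
by case: (_ \in X); rewrite // mulrC.
Qed.

Lemma eigenvalue_biregular (u v : vertex G) : adj u v ->
  eigenvalue A (Num.sqrt (c%:R * d%:R)).
Proof.
move=> uv; pose w (x : vertex G) : R :=
  if x \in X then Num.sqrt c%:R else Num.sqrt d%:R.
have deg_gt0 (x y : vertex G) : adj x y -> (0 < degree x)%N.
  by move=> xy; apply/card_gt0P; exists y; rewrite inE.
(* The edge makes the degree of [u] positive, and [w u] is the square root of that degree. *)
have w_neq0 : w u != 0.
  have := deg_gt0 _ _ uv; rewrite degree_biregular /w.
  by case: ifP => _ ?; rewrite sqrtr_eq0 -ltNge ltr0n.
apply/eigenvalueP; exists (\row_i w (enum_val i)).
  apply/rowP => j; rewrite !mxE.
  (* Symmetry of [A] turns this sum down column [j] into one along row [j], from which the common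
     value of [w] at the neighbours factors out. *)
  under eq_bigr => i _ do
    rewrite mxE mulrC -[A]adjacency_matrix_tr mxE adjacency_mul_other.
  rewrite -mulr_suml sum_adjacency_row sqrtrM ?ler0n // /w.
  have sqE m : m%:R = Num.sqrt m%:R ^+ 2 :> R by rewrite sqr_sqrtr ?ler0n.
  by case: ifP => _; rewrite {1}sqE; ring.
apply: contra_neq w_neq0 => /rowP/(_ (enum_rank u)).
by rewrite !mxE enum_rankK.
Qed.

Lemma eigenvalues0_biregular (u v : vertex G) : adj u v ->
  (eigenvalues A)`_0 ^+ 2 = c%:R * d%:R.
Proof.
move=> uv; have [sz chA _] := symmetric_eigenvalues adjacency_matrix_tr.
have eigA a : eigenvalue A a = (a \in eigenvalues A).
  by rewrite eigenvalue_root_char chA root_prod_XsubC.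
(* This makes entry 0 a genuine eigenvalue rather than the default value of [nth]. *)
have n_gt0 : (0 < size (eigenvalues A))%N.
  by rewrite sz; apply/card_gt0P; exists u.
set k := (eigenvalues A)`_0.
have k2 : k ^+ 2 <= c%:R * d%:R.
  by apply: eigenvalue_biregular_le; rewrite eigA mem_nth.
have := eigenvalue_biregular uv; rewrite eigA => /(nthP 0)[i i_lt sE].
have ge_tr : transitive (>=%R : rel R).
  by move=> y x z xy yz; exact: le_trans yz xy.
have : Num.sqrt (c%:R * d%:R) <= k.
  rewrite -sE; apply: (sorted_leq_nth ge_tr _ 0 (eigenvalues_sorted A)) => //.
  exact: lexx.
move=> le_k; apply/le_anti; rewrite k2 /=.
rewrite -[leLHS]sqr_sqrtr ?mulr_ge0 ?ler0n // lerXn2r ?nnegrE ?sqrtr_ge0 //.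
exact: le_trans (sqrtr_ge0 _) le_k.
Qed.

End BipartiteGraph.

(** * From the spectrum to the two bounds *)

(** The first step of a path between two distinct vertices is an edge. *)
Lemma connected_adj (G : sgraph) : connected_graph G -> (1 < #|vertex G|)%N ->
  exists u v : vertex G, adj u v.
Proof.
move=> [_ conn] /card_gt1P[u [v [_ _ uv]]].
have /connectP[[|w p] /=] := conn u v.
  by move=> _ E; rewrite E eqxx in uv.
by case/andP => uw _ _; exists u, w.
Qed.

Unset Implicit Arguments.

Theorem theorem3p4 (R : rcfType) (G : sgraph) (n c d : nat)
    (X Y : {set vertex G}) :
  #|vertex G| = n -> (4 <= n)%N ->
  connected_graph G ->
  bipartition X Y ->
  (forall x, x \in X -> degree x = c) ->
  (forall y, y \in Y -> degree y = d) ->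
  Num.sqrt (2 * (#|edges G|%:R - c%:R * d%:R) / ((n%:R - 2) * (n%:R - 3)))
    <= lambda2 R G
    <= Num.sqrt (2 * (n%:R - 3) * (#|edges G|%:R - c%:R * d%:R) / (n%:R - 2)).
Proof.
move=> cardG n4 connG XY degX degY.
have [u [v uv]] : exists u v : vertex G, adj u v.
  by apply: connected_adj => //; rewrite cardG; exact: leq_trans n4.
have [sz _ trA] := symmetric_eigenvalues (adjacency_matrix_tr R G).
have sz_n := etrans sz cardG.
have := @sorted_symmetric_second _ _ (eigenvalues_sorted _)
  (eigenvalues_bipartite R XY).
rewrite {}sz_n -trA (trace_adjacency_sqr R XY).
rewrite (eigenvalues0_biregular R XY degX degY uv) -mulrBr -/(lambda2 R G).
(* With [q = |E| - cd], [ub] reads [2 l^2 <= 2 q] and [lb] reads [2 q <= (n - 2) l^2]. *)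
move=> /(_ n4) []; set l := lambda2 R G; set q := _ - _ * _ => l_ge0 ub lb.
have n4R : 4 <= n%:R :> R by rewrite ler_nat.
have l2_ge0 := sqr_ge0 l.
(* As [l] is nonnegative it equals the square root of [l^2], so it suffices to compare radicands. *)
rewrite -[l]ger0_norm // -sqrtr_sqr; apply/andP; split; apply: ler_wsqrtr.
  rewrite ler_pdivrMr ?mulr_gt0 ?subr_gt0 //; try lra.
  (* Multiply the right side of [lb] by [n - 3 >= 1]. *)
  nra.
rewrite ler_pdivlMr; last lra.
(* From [n >= 4] comes [n - 2 <= 2 (n - 3)]; combine this with [0 <= l^2 <= q]. *)
nra.
Qed.
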